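(* Let $X$ be a finite set of variables, $Z,P\subseteq\mathbb{Q}[X]$ finite with $Z$ a Gröbner basis, $Y$ a finite set of variables disjoint from $X$, and $f:\mathbb{Q}[Y]\to\mathbb{Q}[X]$ a ring homomorphism. Then \[ \mathrm{alg.cone}_Y(\mathit{inverse\text{-}hom}(Z,P,f,Y))=f^{-1}(\mathrm{alg.cone}_X(Z,P)). \]
   Context: $\mathit{inverse\text{-}hom}(Z,P,f,Y)=\mathit{project}_Y(\{y-f(y):y\in Y\}\cup Z,\ P)$, computed in $\mathbb{Q}[X\cup Y]$. For finite $Z,P\subseteq\mathbb{Q}[V]$, $\mathrm{alg.cone}_V(Z,P)=\langle Z\rangle_V+\mathrm{cone}(P)$ (ideal of $\mathbb{Q}[V]$ generated by $Z$ plus non-negative rational combinations of $P$). For $W\subseteq V$ and finite $Z,P\subseteq\mathbb{Q}[V]$, with a fixed monomial ordering $\preceq$: the elimination ordering $\preceq_W$ compares monomials $m=m_Wm_{\overline W}$, $n=n_Wn_{\overline W}$ (parts over $W$ and over $V\setminus W$) by $m\preceq_W n$ iff $m_{\overline W}\prec n_{\overline W}$, or $m_{\overline W}=n_{\overline W}$ and $m_W\preceq n_W$; $\mathit{project}_W(Z,P)=\langle G\cap\mathbb{Q}[W],\mathrm{proj}(\{\mathbf{red}_G(p):p\in P\},[W])\rangle$, where $G$ is a Gröbner basis of the ideal generated by $Z$ in $\mathbb{Q}[V]$ w.r.t. $\preceq_W$, $\mathbf{red}_G$ is normal form modulo $G$, $[W]$ the monomials over $W$, and $\mathrm{proj}(S,N)$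 a finite set with $\mathrm{cone}(\mathrm{proj}(S,N))=\mathrm{cone}(S)\cap\mathrm{span}_{\mathbb{Q}}(N)$. *)

(* Defs.v *)
(* Finite sets of polynomials are given by sequences enumerating them; repeated
   entries affect none of the notions below. *)
From mathcomp Require Import all_boot all_order all_algebra.
From mathcomp Require Import mpoly.
From Stdlib Require Import Relation_Operators.

Set Implicit Arguments.
Unset Strict Implicit.
Unset Printing Implicit Defensive.

Import GRing.Theory.
Local Open Scope ring_scope.

Section AlgebraicCones.
Variable k : nat.
Implicit Types (p q : {mpoly rat[k]}) (Z P : seq {mpoly rat[k]}).

Definition ideal_gen (S : {mpoly rat[k]} -> Prop) (p : {mpoly rat[k]}) : Prop :=
  exists2 s : seq ({mpoly rat[k]} * {mpoly rat[k]}),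
    (forall x, x \in s -> S x.2) & p = \sum_(x <- s) x.1 * x.2.

Definition ideal_of Z : {mpoly rat[k]} -> Prop := ideal_gen (fun q => q \in Z).

Definition cone P (p : {mpoly rat[k]}) : Prop :=
  exists2 c : {mpoly rat[k]} -> rat,
    (forall q, 0 <= c q) & p = \sum_(q <- P) c q *: q.

Definition alg_cone Z P (p : {mpoly rat[k]}) : Prop :=
  exists a b, [/\ ideal_of Z a, cone P b & p = a + b].

Definition mnm_span (N : pred 'X_{1..k}) (p : {mpoly rat[k]}) : Prop :=
  exists (s : seq 'X_{1..k}) (c : 'X_{1..k} -> rat),
    all N s /\ p = \sum_(m <- s) c m *: 'X_[m].

End AlgebraicCones.

Section Groebner.
Variable k : nat.
Implicit Types (le : rel 'X_{1..k}) (p q g r : {mpoly rat[k]}).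
Implicit Types (G : seq {mpoly rat[k]}).

(* Monomials are written additively: 0%MM is the monomial 1 and (m + n)%MM is
   the product of m and n. *)
Definition monomial_ordering le : Prop :=
  [/\ total le, antisymmetric le, transitive le,
      forall m, le 0%MM m
    & forall m n u, le m n -> le (m + u)%MM (n + u)%MM].

(* The junk value at p = 0 is 0%MM, so that lterm le 0 = 0. *)
Definition lmonom le p : 'X_{1..k} :=
  foldr (fun m n => if le m n then n else m) 0%MM (msupp p).

Definition lcoef le p : rat := p@_(lmonom le p).

Definition lterm le p : {mpoly rat[k]} := lcoef le p *: 'X_[lmonom le p].

Definition groebner_basis_of le (I : {mpoly rat[k]} -> Prop) G : Prop :=
  (forall g, g \in G -> I g) /\
  (forall p, ideal_gen (fun t => exists2 g, g \in G & t = lterm le g) p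
         <-> ideal_gen (fun t => exists2 g, I g & t = lterm le g) p).

Definition groebner_basis le G : Prop := groebner_basis_of le (ideal_of G) G.

Definition reduce1 le G p q : Prop :=
  exists g m, [/\ g \in G, g != 0, (lmonom le g + m)%MM \in msupp p
    & q = p - (p@_(lmonom le g + m) / lcoef le g) *: ('X_[m] * g)].

Definition normal_form le G p r : Prop :=
  clos_refl_trans _ (reduce1 le G) p r /\ forall q, ~ reduce1 le G r q.

End Groebner.

Section Projection.
Variables (k : nat) (W : {set 'I_k}).

Definition mnm_part (A : {set 'I_k}) (m : 'X_{1..k}) : 'X_{1..k} :=
  [multinom (if i \in A then m i else 0%N) | i < k].

Definition elim_le (le : rel 'X_{1..k}) : rel 'X_{1..k} := fun m n =>
  let mW := mnm_part W m in let mC := mnm_part (~: W) m in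
  let nW := mnm_part W n in let nC := mnm_part (~: W) n in
  (mC != nC) && le mC nC || (mC == nC) && le mW nW.

Definition mnm_over (m : 'X_{1..k}) : bool := [forall i, (0 < m i)%N ==> (i \in W)].

Definition mpoly_over (p : {mpoly rat[k]}) : bool := all mnm_over (msupp p).

(* T is a possible value of proj(S, N). *)
Definition is_proj (S : seq {mpoly rat[k]}) (N : pred 'X_{1..k})
    (T : seq {mpoly rat[k]}) : Prop :=
  forall p, cone T p <-> cone S p /\ mnm_span N p.

(* project_W is determined only up to the choice of the Groebner basis and of
   proj; is_project says that (Z', P') is the result for some such choice.
   Elements of Q[W] are kept here as polynomials in all k variables. *)
Definition is_project (le : rel 'X_{1..k}) (Z P Z' P' : seq {mpoly rat[k]}) : Prop :=
  exists (G : seq {mpoly rat[k]}) (red : {mpoly rat[k]} -> {mpoly rat[k]}),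
    [/\ groebner_basis_of (elim_le le) (ideal_of Z) G,
        forall p, p \in P -> normal_form (elim_le le) G p (red p),
        Z' =i [seq g <- G | mpoly_over g]
      & is_proj [seq red p | p <- P] mnm_over P'].

End Projection.

(* X has n variables, Y has m variables, and the disjoint union of X and Y is
   indexed by 'I_(n + m): lshift for the variables of X, rshift for those of Y. *)
Section InverseHom.
Variables n m : nat.

Definition inclX (p : {mpoly rat[n]}) : {mpoly rat[n + m]} :=
  p \mPo [tuple 'X_(lshift m i) | i < n].

Definition inclY (q : {mpoly rat[m]}) : {mpoly rat[n + m]} :=
  q \mPo [tuple 'X_(rshift n j) | j < m].

Definition mnm_inclX (u : 'X_{1..n}) : 'X_{1..n + m} :=
  [multinom (if split i is inl j then u j else 0%N) | i < n + m].

Definition restrX (le : rel 'X_{1..n + m}) : rel 'X_{1..n} :=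
  fun u v => le (mnm_inclX u) (mnm_inclX v).

Definition varsY : {set 'I_(n + m)} := [set rshift n j | j : 'I_m].

(* (Z', P') is a possible value of inverse-hom(Z, P, f, Y), read as a pair of
   finite subsets of Q[Y]. *)
Definition is_inverse_hom (le : rel 'X_{1..n + m}) (Z P : seq {mpoly rat[n]})
    (f : {mpoly rat[m]} -> {mpoly rat[n]}) (Z' P' : seq {mpoly rat[m]}) : Prop :=
  is_project varsY le
    ([seq inclY 'X_j - inclX (f 'X_j) | j <- enum 'I_m] ++ map inclX Z)
    (map inclX P) (map inclY Z') (map inclY P').

End InverseHom.

(* Main.v *)
(** Let I be the ideal of Q[X, Y] generated by Z and the y - f(y). It is the
    preimage of <Z> under the retraction Q[X, Y] -> Q[X] that sends y to f(y), so
    f(q) lies in alg.cone(Z, P) iff q is congruent modulo I to some r in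
    cone(red_G(P)). Such an r is reduced, hence it is the normal form of q.
    Under the elimination ordering, reducing q in Q[Y] only ever uses elements of
    G that lie in Q[Y]; therefore r lies in Q[Y] and q - r in the ideal generated
    by the part of G in Q[Y]. The division terminates because monomial orderings are
    well-founded, by Dickson's lemma. *)
Require Import Defs.
From HB Require Import structures.
From mathcomp Require Import all_boot all_order all_algebra.
From mathcomp Require Import mpoly ring.
From Stdlib Require Import Classical IndefiniteDescription Relation_Operators.

Set Implicit Arguments.
Unset Strict Implicit.
Unset Printing Implicit Defensive.

Import GRing.Theory Num.Theory.
Local Open Scope ring_scope.

(** * Well-foundedness of monomial orderings *)

(** Every tail of [g] attains a minimum. Each chosen index realises the minimum of a tail that
    contains all later choices, so the chosen values never decrease. *)
Lemma nondecreasing_subsequence (g : nat -> nat) :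
  exists2 s : nat -> nat, {homo s : i j / (i < j)%N} &
    {homo (fun i => g (s i)) : i j / (i <= j)%N}.
Proof.
have min_after (i : nat) :
    exists j, (i <= j)%N /\ (forall l, (i <= l)%N -> (g j <= g l)%N).
  have [v] : exists v, exists2 j, (i <= j)%N & g j = v by exists (g i), i.
  elim/ltn_ind: v => v IHv [j le_ij gj].
  have [min_j | ] := classic (forall l, (i <= l)%N -> (g j <= g l)%N).
    by exists j.
  move=> /not_all_ex_not[l not_le].
  have [le_il /negP] := imply_to_and _ _ not_le.
  by rewrite -ltnNge gj => lt_gl; apply: (IHv _ lt_gl); exists l.
have [h hP] := functional_choice _ min_after.
pose s := fix s i := if i is i'.+1 then h (s i').+1 else h 0%N.
have s_min i : exists2 x, (x <= s i)%N & forall l, (x <= l)%N -> (g (s i) <= g l)%N.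
  case: i => [|i] /=; first by exists 0%N => // l _; have [_] := hP 0%N; apply.
  by have [le_h min_h] := hP (s i).+1; exists (s i).+1.
have sS i : (s i < s i.+1)%N by rewrite /=; have [] := hP (s i).+1.
exists s; first exact: homo_ltn ltn_trans sS.
apply: homo_leq leqnn leq_trans _ => i; have [x le_x min_x] := s_min i.
by apply: min_x; apply: leq_trans le_x (ltnW (sS i)).
Qed.

(** Extracting a nondecreasing subsequence for one coordinate after another makes all exponents
    monotone at once; the first two surviving terms then compare. *)
Lemma dickson k (u : nat -> 'X_{1..k}) :
  exists i j, (i < j)%N /\ (u i <= u j)%MM.
Proof.
have subseqP (A : seq 'I_k) : exists2 s : nat -> nat, {homo s : i j / (i < j)%N} &
    forall a, a \in A -> {homo (fun i => u (s i) a) : i j / (i <= j)%N}.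
  elim: A => [|a A [s s_inc s_mono]]; first by exists id.
  have [t t_inc t_mono] := nondecreasing_subsequence (fun i => u (s i) a).
  exists (s \o t) => [i j lt_ij | b]; first exact/s_inc/t_inc.
  rewrite inE => /predU1P[-> // | bA] i j le_ij.
  by apply: s_mono => //; move: i j le_ij; apply: ltnW_homo.
have [s s_inc s_mono] := subseqP (enum 'I_k).
exists (s 0%N), (s 1%N); split; first exact: s_inc.
by apply/mnm_lepP => a; apply: (s_mono a) => //; rewrite mem_enum.
Qed.

Section MonomialOrdering.
Variables (k : nat) (le : rel 'X_{1..k}).
Hypothesis le_ord : monomial_ordering le.
Implicit Types (m t u : 'X_{1..k}) (p q g r : {mpoly rat[k]}).
Implicit Types (G : seq {mpoly rat[k]}).

Let le_total : total le. Proof. by case: le_ord. Qed.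
Let le_anti : antisymmetric le. Proof. by case: le_ord. Qed.
Let le_trans : transitive le. Proof. by case: le_ord. Qed.
Let le0 m : le 0%MM m. Proof. by case: le_ord. Qed.
Let leD m t u : le m t -> le (m + u)%MM (t + u)%MM.
Proof. by case: le_ord => _ _ _ _; apply. Qed.
Let le_refl m : le m m. Proof. by have := le_total m m; rewrite orbb. Qed.

Lemma monomial_ordering_dvd m t : (m <= t)%MM -> le m t.
Proof. by move=> /submK <-; rewrite -{1}[m]add0m; apply: leD. Qed.

(** An inaccessible monomial starts an infinite strictly decreasing sequence [w]. By Dickson some
    [w i] divides a later [w j], so [w i] is below [w j], hence below [w i.+1], and antisymmetry
    contradicts strictness. *)
Lemma monomial_ordering_wf : well_founded (fun m t => le m t && (m != t)).
Proof.
move=> m; apply: NNPP => m_bad.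
pose bad := {m | ~ Acc (fun m t => le m t && (m != t)) m}.
have step (x : bad) : exists y : bad, le (sval y) (sval x) && (sval y != sval x).
  case: x => x x_bad /=; apply: NNPP => no_y; apply: x_bad; constructor => y lt_yx.
  by apply: NNPP => y_bad; apply: no_y; exists (exist _ y y_bad).
have [h hP] := functional_choice _ step.
pose w i := sval (iter i h (exist _ m m_bad)).
have wS i : le (w i.+1) (w i) && (w i.+1 != w i) by apply: hP.
have w_dec : {homo w : i j / (i <= j)%N >-> le j i}.
  apply: (homo_leq (r := fun x y => le y x)) => [x | x y z xy yz | i].
  - exact: le_refl.
  - exact: le_trans yz xy.
  - by case/andP: (wS i).
have [i [j [lt_ij dvd_ij]]] := dickson w.
have /andP[_ /eqP[]] := wS i; apply: le_anti.
have /andP[-> _] := wS i; rewrite /=.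
exact: le_trans (monomial_ordering_dvd dvd_ij) (w_dec _ _ lt_ij).
Qed.

Lemma lmonom_max p m : m \in msupp p -> le m (lmonom le p).
Proof.
rewrite /lmonom; elim: (msupp p) => //= t s IHs; rewrite inE.
have := le_total t (foldr (fun m n => if le m n then n else m) 0%MM s).
case: ifP => /= [le_t _ /predU1P[-> // | /IHs //] | _ le_t /predU1P[-> // | /IHs ms]].
exact: le_trans ms le_t.
Qed.

Lemma lmonom_supp p : p != 0 -> lmonom le p \in msupp p.
Proof.
rewrite -msupp_eq0 /lmonom; elim: (msupp p) => //= t s IHs _; rewrite inE.
case: ifP => [le_t | _]; last by rewrite eqxx.
(* On an empty tail the fold returns its default [0%MM], and [le t 0%MM] forces [t] to be [0%MM]
   itself. *)
have [s0 | nz_s] := eqVneq s [::]; last by rewrite IHs ?orbT.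
rewrite s0 /= in le_t *.
by apply/orP; left; apply/eqP/le_anti; rewrite le0.
Qed.

Lemma lcoef_neq0 p : p != 0 -> lcoef le p != 0.
Proof. by move=> nz_p; rewrite /lcoef -mcoeff_msupp lmonom_supp. Qed.

End MonomialOrdering.

(** * Splitting monomials along W, and the elimination ordering *)

Lemma mnm_partD k (A : {set 'I_k}) m t :
  mnm_part A (m + t) = (mnm_part A m + mnm_part A t)%MM.
Proof. by apply/mnmP => i; rewrite !mnmE; case: ifP. Qed.

Lemma mnm_part0 k (A : {set 'I_k}) : mnm_part A 0%MM = 0%MM.
Proof. by apply/mnmP => i; rewrite !mnmE; case: ifP. Qed.

Lemma mnm_partK k (A : {set 'I_k}) m : (mnm_part A m + mnm_part (~: A) m)%MM = m.
Proof. by apply/mnmP => i; rewrite !mnmE inE; case: ifP; rewrite ?addn0. Qed.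

Lemma mnm_overE k (W : {set 'I_k}) m : mnm_over W m = (mnm_part (~: W) m == 0%MM).
Proof.
apply/forallP/eqP => [mW | /mnmP mW i].
  by apply/mnmP => i; rewrite !mnmE inE; have := mW i; case: (i \in W); case: (m i).
by have := mW i; rewrite !mnmE inE; case: (i \in W) => /= [_ | ->]; rewrite ?implybT.
Qed.

Lemma mnm_overD k (W : {set 'I_k}) m t :
  mnm_over W (m + t) = mnm_over W m && mnm_over W t.
Proof.
rewrite !mnm_overE mnm_partD.
apply/eqP/andP => [/mnmP mt0 | [/eqP -> /eqP ->]]; last by rewrite addm0.
split; apply/eqP/mnmP => i; have /eqP := mt0 i;
  by rewrite mnmDE mnm0E addn_eq0 => /andP[/eqP m0 /eqP t0]; rewrite ?m0 ?t0 ?mnm0E.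
Qed.

(** This is a lexicographic comparison, outer part first. The two parts determine the monomial,
    which gives antisymmetry, and both are additive, which gives compatibility with products. *)
Lemma elim_le_ordering k (W : {set 'I_k}) le :
  monomial_ordering le -> monomial_ordering (elim_le W le).
Proof.
case=> le_total le_anti le_trans le0 leD; rewrite /elim_le.
split=> [m t | m t | t m u | m | m t u].
- by rewrite eq_sym; case: eqP => /= _; rewrite ?orbF ?le_total.
- rewrite [mnm_part (~: W) t == _]eq_sym.
  case: eqP => /= [eqC eqW | neqC]; last first.
    by rewrite !orbF => /le_anti.
  by rewrite -(mnm_partK W m) -(mnm_partK W t) eqC (le_anti _ _ eqW).
- case: eqVneq => [-> | neq_mt] /=.
    case: eqVneq => [_ | //] /=; exact: le_trans.
  case: eqVneq => [<- | neq_tu] /=; first by rewrite (negPf neq_mt) /= !orbF => ->.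
  rewrite !orbF => le_mt le_tu; rewrite (le_trans _ _ _ le_mt le_tu) andbT.
  case: eqVneq => [eq_mu | //] /=; move/eqP: neq_tu; case; apply: le_anti.
  by rewrite le_tu -eq_mu le_mt.
- by rewrite !mnm_part0 !le0 !andbT orbC orbN.
- rewrite !mnm_partD eqm_add2r.
  by case/orP => /andP[-> le_mt] /=; rewrite leD ?orbT.
Qed.

(** The elimination property: the outer part of [m] is at most that of [t], which is the least
    monomial 1. *)
Lemma elim_le_over k (W : {set 'I_k}) le m t :
  monomial_ordering le -> elim_le W le m t -> mnm_over W t -> mnm_over W m.
Proof.
case=> _ le_anti _ le0 _; rewrite !mnm_overE /elim_le => + /eqP t0; rewrite t0.
by case/orP => /andP[// neq le_m]; apply/eqP/le_anti; rewrite le0 le_m.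
Qed.

(** * Ideals and cones *)

Section IdealGen.
Variables (k : nat) (S : {mpoly rat[k]} -> Prop).
Implicit Types a b h : {mpoly rat[k]}.

Lemma ideal_gen0 : ideal_gen S 0.
Proof. by exists [::]; rewrite ?big_nil. Qed.

Lemma ideal_genD a b : ideal_gen S a -> ideal_gen S b -> ideal_gen S (a + b).
Proof.
move=> [s sS ->] [t tS ->]; exists (s ++ t); last by rewrite big_cat.
by move=> x; rewrite mem_cat => /orP[/sS | /tS].
Qed.

Lemma ideal_genM h a : ideal_gen S a -> ideal_gen S (h * a).
Proof.
move=> [s sS ->]; exists [seq (h * x.1, x.2) | x <- s].
  by move=> _ /mapP[x xs ->]; apply: (sS x).
by rewrite big_map mulr_sumr; apply: eq_bigr => x _; rewrite mulrA.
Qed.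

Lemma ideal_gen_mem a : S a -> ideal_gen S a.
Proof.
move=> Sa; exists [:: (1, a)]; last by rewrite big_seq1 mul1r.
by move=> x; rewrite inE => /eqP->.
Qed.

Lemma ideal_genN a : ideal_gen S a -> ideal_gen S (- a).
Proof. by rewrite -mulN1r; apply: ideal_genM. Qed.

Lemma ideal_genB a b : ideal_gen S a -> ideal_gen S b -> ideal_gen S (a - b).
Proof. by move=> Ia Ib; apply/ideal_genD/ideal_genN. Qed.

Lemma ideal_genZ c a : ideal_gen S a -> ideal_gen S (c *: a).
Proof. by rewrite -mul_mpolyC; apply: ideal_genM. Qed.

Lemma ideal_gen_sum (I : eqType) (s : seq I) (F : I -> {mpoly rat[k]}) :
  (forall i, i \in s -> ideal_gen S (F i)) -> ideal_gen S (\sum_(i <- s) F i).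
Proof.
move=> FS; rewrite big_seq; elim/big_ind: _ => //; first exact: ideal_gen0.
exact: ideal_genD.
Qed.

End IdealGen.

Lemma ideal_gen_rmorph k l (f : {rmorphism {mpoly rat[k]} -> {mpoly rat[l]}})
    (S : {mpoly rat[k]} -> Prop) (T : {mpoly rat[l]} -> Prop) a :
  (forall g, S g -> ideal_gen T (f g)) -> ideal_gen S a -> ideal_gen T (f a).
Proof.
move=> ST [s sS ->]; rewrite rmorph_sum; apply: ideal_gen_sum => x /sS Sx.
by rewrite rmorphM; apply/ideal_genM/ST.
Qed.

Lemma ideal_gen_subset k (S T : {mpoly rat[k]} -> Prop) a :
  (forall g, S g -> ideal_gen T g) -> ideal_gen S a -> ideal_gen T a.
Proof. exact: (@ideal_gen_rmorph k k idfun). Qed.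

Section Cone.
Variables (k : nat) (P : seq {mpoly rat[k]}).
Implicit Types a b : {mpoly rat[k]}.

Lemma cone0 : cone P 0.
Proof. by exists (fun _ => 0) => //; rewrite big1 // => q _; rewrite scale0r. Qed.

Lemma coneD a b : cone P a -> cone P b -> cone P (a + b).
Proof.
move=> [c c0 ->] [d d0 ->]; exists (fun q => c q + d q) => [q|].
  by rewrite addr_ge0.
by rewrite -big_split; apply: eq_bigr => q _; rewrite scalerDl.
Qed.

(* The coefficient is split evenly among the occurrences of [q] in [P]. *)
Lemma cone_ray c q : 0 <= c -> q \in P -> cone P (c *: q).
Proof.
move=> c0 qP; exists (fun r => if r == q then c / (count_mem q P)%:R else 0).
  by move=> r; case: ifP; rewrite // divr_ge0.
rewrite (eq_bigr (fun r => if r == q then (c / (count_mem q P)%:R) *: q else 0)).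
  rewrite -big_mkcond big_const_seq iter_addr_0 -scaler_nat scalerA mulrC divfK //.
  by rewrite pnatr_eq0 -lt0n -has_count has_pred1.
by move=> r _; case: eqP => [-> // | _]; rewrite scale0r.
Qed.

Lemma cone_sum (I : eqType) (s : seq I) (F : I -> {mpoly rat[k]}) :
  (forall i, i \in s -> cone P (F i)) -> cone P (\sum_(i <- s) F i).
Proof.
move=> FP; rewrite big_seq; elim/big_ind: _ => //; first exact: cone0.
exact: coneD.
Qed.

End Cone.

(** * Reduction modulo a Groebner basis *)

(** Irreducibility is phrased through the support so that it visibly passes to linear combinations,
    in particular to conic combinations of normal forms. *)
Definition reduced k (le : rel 'X_{1..k}) (G : seq {mpoly rat[k]})
    (r : {mpoly rat[k]}) : Prop :=
  forall g t, g \in G -> g != 0 -> t \in msupp r -> ~~ (lmonom le g <= t)%MM.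

Section Reduction.
Variables (k : nat) (le : rel 'X_{1..k}) (G : seq {mpoly rat[k]}).
Implicit Types p q g r : {mpoly rat[k]}.

Lemma reduced0 : reduced le G 0.
Proof. by move=> g t _ _; rewrite msupp0. Qed.

Lemma reducedD p q : reduced le G p -> reduced le G q -> reduced le G (p + q).
Proof.
move=> rp rq g t gG g0 /msuppD_le; rewrite mem_cat.
by case/orP => ts; [apply: rp | apply: rq].
Qed.

Lemma reducedZ c p : reduced le G p -> reduced le G (c *: p).
Proof. by move=> rp g t gG g0 /msuppZ_le ts; apply: rp. Qed.

Lemma reducedB p q : reduced le G p -> reduced le G q -> reduced le G (p - q).
Proof. by move=> rp rq; rewrite -scaleN1r; apply/reducedD/reducedZ. Qed.

Lemma reduced_sum (I : eqType) (s : seq I) (F : I -> {mpoly rat[k]}) :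
  (forall i, i \in s -> reduced le G (F i)) -> reduced le G (\sum_(i <- s) F i).
Proof.
move=> FG; rewrite big_seq; elim/big_ind: _ => //; first exact: reduced0.
exact: reducedD.
Qed.

Lemma normal_form_reduced p r : normal_form le G p r -> reduced le G r.
Proof.
case=> _ r_irr g t gG g0 ts; apply/negP => dvd_t; apply: (r_irr _).
by exists g, (t - lmonom le g)%MM; split; last reflexivity; rewrite // addmC submK.
Qed.

(** Each reduction step subtracts a multiple of an element of [G]; the differences telescope. *)
Lemma normal_form_ideal (S : {mpoly rat[k]} -> Prop) p r :
  (forall g, g \in G -> ideal_gen S g) -> normal_form le G p r ->
  ideal_gen S (p - r).
Proof.
move=> GS [red_pr _]; elim: red_pr => {p r} [p r | p | p q r _ pq _ qr].
- case=> g [t [gG _ _ ->]]; rewrite subKr.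
  exact/ideal_genZ/ideal_genM/GS.
- by rewrite subrr; apply: ideal_gen0.
- by rewrite -(subrKA q); apply: ideal_genD.
Qed.

(** This gives uniqueness of remainders. If [r] were nonzero, its leading term would be a
    combination of leading terms of [G], so one of their monomials would divide a monomial of
    [r]. *)
Lemma reduced_ideal0 (I : {mpoly rat[k]} -> Prop) r :
  monomial_ordering le -> groebner_basis_of le I G -> I r -> reduced le G r -> r = 0.
Proof.
move=> le_ord [_ GI] Ir r_red; apply/eqP/negPn/negP => r0.
have [s sG lr] : ideal_gen (fun t => exists2 g, g \in G & t = lterm le g) (lterm le r).
  by apply/GI/ideal_gen_mem; exists r.
have : (lterm le r)@_(lmonom le r) != 0.
  by rewrite mcoeffZ mcoeffX eqxx mulr1 lcoef_neq0.
rewrite {1}lr raddf_sum big_seq big1 ?eqxx //= => x /sG[g gG ->].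
(* The default leading monomial of 0 divides everything, but its leading term is 0 and contributes
   nothing. *)
have [-> | g0] := eqVneq g 0.
  by rewrite /lterm /lcoef mcoeff0 scale0r mulr0 mcoeff0.
rewrite -scalerAr mcoeffZ; apply/eqP; rewrite mulf_eq0; apply/orP; right.
rewrite mcoeff_eq0 (perm_mem (msuppMX _ _)); apply/negP => /mapP[t _ lrE].
have /negP[] := r_red g _ gG g0 (lmonom_supp le_ord r0).
by rewrite lrE lem_addr.
Qed.

End Reduction.

(** * Division of polynomials over W *)

Lemma mpoly_overP k (W : {set 'I_k}) p :
  reflect (forall t, t \in msupp p -> mnm_over W t) (mpoly_over W p).
Proof. exact: allP. Qed.

Lemma mpoly_overD k (W : {set 'I_k}) p q :
  mpoly_over W p -> mpoly_over W q -> mpoly_over W (p + q).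
Proof.
move=> /mpoly_overP pW /mpoly_overP qW; apply/mpoly_overP => t /msuppD_le.
by rewrite mem_cat => /orP[/pW | /qW].
Qed.

Lemma mpoly_overZ k (W : {set 'I_k}) c p : mpoly_over W p -> mpoly_over W (c *: p).
Proof. by move=> /mpoly_overP pW; apply/mpoly_overP => t /msuppZ_le /pW. Qed.

Lemma mpoly_over0 k (W : {set 'I_k}) : mpoly_over W 0.
Proof. by apply/mpoly_overP => t; rewrite msupp0. Qed.

Section Elimination.
Variables (k : nat) (W : {set 'I_k}) (le : rel 'X_{1..k}) (G : seq {mpoly rat[k]}).
Hypothesis le_ord : monomial_ordering le.
Let leW := elim_le W le.
Let leW_ord : monomial_ordering leW := elim_le_ordering W le_ord.

Lemma elim_lmonom_over g : mnm_over W (lmonom leW g) -> mpoly_over W g.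
Proof.
move=> lgW; apply/mpoly_overP => t /(lmonom_max leW_ord) le_t.
exact: elim_le_over le_ord le_t lgW.
Qed.

(** Only the generators of [u] are required to lie over [W]; their multipliers range over the whole
    ring. The predicate is linear, so it suffices to divide monomials. *)
Let divisible p := exists u r,
  [/\ ideal_gen (fun g => g \in G /\ mpoly_over W g) u, mpoly_over W r,
      reduced leW G r & p = u + r].

Let divisible_lin c p q : divisible p -> divisible q -> divisible (c *: p + q).
Proof.
move=> [u [r [Iu rW r_red ->]]] [v [s [Iv sW s_red ->]]].
exists (c *: u + v), (c *: r + s); split.
- exact/ideal_genD/Iv/ideal_genZ.
- exact/mpoly_overD/sW/mpoly_overZ.
- exact/reducedD/s_red/reducedZ.
- by rewrite scalerDr addrACA.
Qed.

Let divisible_supp p : (forall t, t \in msupp p -> divisible 'X_[t]) -> divisible p.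
Proof.
move=> p_div; rewrite [p]mpolyE; elim: (msupp p) p_div => [|t s IHs] s_div.
  rewrite big_nil; exists 0, 0; rewrite addr0 mpoly_over0; split => //.
    exact: ideal_gen0.
  exact: reduced0.
rewrite big_cons; apply: divisible_lin; first by apply: s_div; rewrite mem_head.
by apply: IHs => u us; apply: s_div; rewrite inE us orbT.
Qed.

(* A monomial over W can only be reduced by elements of G over W, because their
   leading monomials then lie over W. *)
Lemma division_over p : mpoly_over W p -> divisible p.
Proof.
move/mpoly_overP => pW; apply: divisible_supp => m /pW {p pW}.
elim/(well_founded_ind (monomial_ordering_wf leW_ord)): m => m IHm mW.
have [m_red | ] := boolP (all (fun g => (g != 0) ==> ~~ (lmonom leW g <= m)%MM) G).
  exists 0, 'X_[m]; split; rewrite ?add0r //; first exact: ideal_gen0.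
    by apply/mpoly_overP => t; rewrite msuppX inE => /eqP->.
  move=> g t gG g0; rewrite msuppX inE => /eqP->.
  exact: (implyP (allP m_red g gG)).
case/allPn => g gG; rewrite negb_imply negbK => /andP[g0 dvd_m].
pose t := (m - lmonom leW g)%MM.
have mE : (t + lmonom leW g)%MM = m by rewrite submK.
have /andP[tW lgW] : mnm_over W t && mnm_over W (lmonom leW g).
  by rewrite -mnm_overD mE.
have gW := elim_lmonom_over lgW.
(* The scalar [c] makes the multiple of [g] monic at [m]. Hence [m] cancels in [d], whose monomials
   are all strictly smaller and still over [W]. *)
pose c := (lcoef leW g)^-1; pose d := 'X_[m] - c *: (g * 'X_[t]).
rewrite -(subrK (c *: (g * 'X_[t])) 'X_[m]) addrC -/d; apply: divisible_lin.
  exists (g * 'X_[t]), 0; rewrite mpoly_over0 addr0; split => //.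
    by rewrite mulrC; apply/ideal_genM/ideal_gen_mem.
  exact: reduced0.
have dm : m \notin msupp d.
  rewrite -mcoeff_eq0 mcoeffB mcoeffX eqxx mcoeffZ -mE mcoeffMX.
  by rewrite mulVf ?subrr // lcoef_neq0.
apply: divisible_supp => s sd.
have neq_sm : s != m by apply: contraNneq dm => <-.
have /mapP[s' s'g sE] : s \in [seq (t + s')%MM | s' <- msupp g].
  rewrite -(perm_mem (msuppMX _ _)); have := msuppB_le sd.
  by rewrite mem_cat msuppX inE (negPf neq_sm) => /msuppZ_le.
apply: IHm; last by rewrite sE mnm_overD tW (mpoly_overP _ _ gW).
rewrite neq_sm andbT sE -mE; have [_ _ _ _ leD] := leW_ord.
by rewrite ![(t + _)%MM]addmC leD // lmonom_max.
Qed.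

End Elimination.

(** * Inverse images of algebraic cones *)

(** A ring homomorphism between these algebras is automatically linear over the rationals, so its
    values on the variables determine it. *)
Lemma comp_mpoly_unique k l (f : {rmorphism {mpoly rat[k]} -> {mpoly rat[l]}})
    (lq : k.-tuple {mpoly rat[l]}) :
  (forall i, f 'X_i = tnth lq i) -> forall p, f p = p \mPo lq.
Proof.
move=> fX p; rewrite [in LHS](mpolyE p) comp_mpolyEX rmorph_sum.
apply: eq_bigr => t _; rewrite (rat_linear (rmorphB f)) comp_mpolyX mpolyXE_id rmorph_prod.
by congr (_ *: _); apply: eq_bigr => i _; rewrite rmorphXn fX.
Qed.

Lemma comp_mpoly_var k l (lq : k.-tuple {mpoly rat[l]}) i : 'X_i \mPo lq = tnth lq i.
Proof. by rewrite comp_mpolyXU -tnth_nth. Qed.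

(** The polynomials congruent to their image under [g] are closed under sums, scalars and products,
    the last by [ab - g(a)g(b) = a(b - g(b)) + (a - g(a))g(b)]. *)
Lemma ideal_gen_sub_rmorph k (S : {mpoly rat[k]} -> Prop)
    (g : {rmorphism {mpoly rat[k]} -> {mpoly rat[k]}}) :
  (forall i, ideal_gen S ('X_i - g 'X_i)) -> forall p, ideal_gen S (p - g p).
Proof.
move=> gX p.
have gM a b : ideal_gen S (a - g a) -> ideal_gen S (b - g b) ->
    ideal_gen S (a * b - g (a * b)).
  move=> Ia Ib; rewrite rmorphM -(subrKA (a * g b)) -mulrBr -mulrBl [_ * g b]mulrC.
  by apply: ideal_genD; apply: ideal_genM.
have g1 : ideal_gen S (1 - g 1) by rewrite rmorph1 subrr; apply: ideal_gen0.
rewrite (mpolyE p) rmorph_sum -sumrB; apply: ideal_gen_sum => t _.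
rewrite (rat_linear (rmorphB g)) -scalerBr; apply: ideal_genZ.
rewrite mpolyXE_id; elim/big_ind: _ => // i _.
by elim: (t i) => [|e IHe]; rewrite ?expr0 // exprS; apply: gM.
Qed.

(** * Inclusions, retractions and the ideal of the graph of f *)

HB.instance Definition _ n m := GRing.RMorphism.copy (@inclX n m)
  (comp_mpoly [tuple 'X_(lshift m i) | i < n]).

HB.instance Definition _ n m := GRing.RMorphism.copy (@inclY n m)
  (comp_mpoly [tuple 'X_(rshift n j) | j < m]).

Section InverseHomCorrect.
Variables (n m : nat) (f : {rmorphism {mpoly rat[m]} -> {mpoly rat[n]}}).
Variable Z : seq {mpoly rat[n]}.

Lemma inclX_var i : inclX m 'X_i = 'X_(lshift m i) :> {mpoly rat[n + m]}.
Proof. by rewrite /inclX comp_mpoly_var tnth_mktuple. Qed.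

Lemma inclY_var j : inclY n 'X_j = 'X_(rshift n j) :> {mpoly rat[n + m]}.
Proof. by rewrite /inclY comp_mpoly_var tnth_mktuple. Qed.

Definition evalX : {mpoly rat[n + m]} -> {mpoly rat[n]} :=
  comp_mpoly [tuple match split i with inl j => 'X_j | inr j => f 'X_j end | i < n + m].

HB.instance Definition _ := GRing.RMorphism.copy evalX
  (comp_mpoly [tuple match split i with inl j => 'X_j | inr j => f 'X_j end | i < n + m]).

(** A left inverse of [inclY], used to bring multipliers from the ring in all variables back to
    Q[Y]. *)
Definition evalY : {mpoly rat[n + m]} -> {mpoly rat[m]} :=
  comp_mpoly [tuple match split i with inl _ => 0 | inr j => 'X_j end | i < n + m].

HB.instance Definition _ := GRing.RMorphism.copy evalY
  (comp_mpoly [tuple match split i with inl _ => 0 | inr j => 'X_j end | i < n + m]).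

Lemma evalX_lshift i : evalX 'X_(lshift m i) = 'X_i.
Proof. by rewrite /evalX comp_mpoly_var tnth_mktuple (unsplitK (inl _ i)). Qed.

Lemma evalX_rshift j : evalX 'X_(rshift n j) = f 'X_j.
Proof. by rewrite /evalX comp_mpoly_var tnth_mktuple (unsplitK (inr _ j)). Qed.

Lemma evalY_rshift j : evalY 'X_(rshift n j) = 'X_j.
Proof. by rewrite /evalY comp_mpoly_var tnth_mktuple (unsplitK (inr _ j)). Qed.

Lemma inclXK : cancel (@inclX n m) evalX.
Proof.
move=> p; rewrite -[RHS]comp_mpoly_id -[LHS]/((evalX \o @inclX n m) p).
by apply: comp_mpoly_unique => i; rewrite tnth_mktuple /= inclX_var evalX_lshift.
Qed.

Lemma inclYK : cancel (@inclY n m) evalY.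
Proof.
move=> p; rewrite -[RHS]comp_mpoly_id -[LHS]/((evalY \o @inclY n m) p).
by apply: comp_mpoly_unique => i; rewrite tnth_mktuple /= inclY_var evalY_rshift.
Qed.

Lemma evalX_inclY q : evalX (inclY n q) = f q.
Proof.
pose lq := [tuple f 'X_j | j < m].
rewrite (@comp_mpoly_unique _ _ f lq) => [|j]; last by rewrite tnth_mktuple.
rewrite -[LHS]/((evalX \o @inclY n m) q).
by apply: comp_mpoly_unique => i; rewrite tnth_mktuple /= inclY_var evalX_rshift.
Qed.

Lemma inclY_over q : mpoly_over (varsY n m) (inclY n q).
Proof.
rewrite /inclY comp_mpolyEX; elim/big_ind: _ => [||t _].
- exact: mpoly_over0.
- exact: mpoly_overD.
apply: mpoly_overZ; rewrite comp_mpolyX.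
under eq_bigr do rewrite tnth_mktuple mpolyXn.
rewrite mprodXE; apply/mpoly_overP => u; rewrite msuppX inE => /eqP-> {u}.
elim/big_ind: _ => [|u v uW vW|j _]; rewrite ?mnm_overD ?uW //.
  by rewrite mnm_overE mnm_part0.
apply/forallP => i; rewrite mulmnE mnm1E; case: eqP => [<-|_]; rewrite ?mul0n //.
by rewrite imset_f ?implybT.
Qed.

Definition graph_gens :=
  [seq inclY n 'X_j - inclX m (f 'X_j) | j <- enum 'I_m] ++ map (@inclX n m) Z.

(* Modulo the generators [y - f y], every polynomial equals its image under evalX. *)
Lemma graph_idealE p : ideal_of graph_gens p <-> ideal_of Z (evalX p).
Proof.
split.
  apply: ideal_gen_rmorph => g; rewrite mem_cat => /orP[|] /mapP[x xZ ->].
    by rewrite rmorphB /= evalX_inclY inclXK subrr; apply: ideal_gen0.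
  by rewrite /= inclXK; apply: ideal_gen_mem.
move=> Ip; rewrite -(subrK (inclX m (evalX p)) p); apply: ideal_genD.
  (* The composite fixes the variables of X and sends y to f(y), so its congruence with the identity
     is checked on variables. *)
  apply: (ideal_gen_sub_rmorph (g := @inclX n m \o evalX)) => i.
  rewrite -[i]splitK; case: (split i) => j /=.
    by rewrite evalX_lshift inclX_var subrr; apply: ideal_gen0.
  rewrite evalX_rshift -inclY_var; apply: ideal_gen_mem.
  by rewrite mem_cat; apply/orP; left; apply/mapP; exists j; rewrite ?mem_enum.
apply: (ideal_gen_rmorph (f := @inclX n m)) Ip => z zZ; apply: ideal_gen_mem.
by rewrite mem_cat map_f ?orbT.
Qed.

End InverseHomCorrect.

Theorem theorem4p7 (n m : nat) (le : rel 'X_{1..n + m})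
    (le_ord : monomial_ordering le)
    (Z P : seq {mpoly rat[n]})
    (Z_gb : groebner_basis (restrX le) Z)
    (f : {rmorphism {mpoly rat[m]} -> {mpoly rat[n]}})
    (Z' P' : seq {mpoly rat[m]})
    (out : is_inverse_hom le Z P f Z' P') :
  forall q : {mpoly rat[m]}, alg_cone Z' P' q <-> alg_cone Z P (f q).
Proof.
move=> q; case: out => G [red [G_gb red_nf Z'G projP']].
have leW_ord := elim_le_ordering (varsY n m) le_ord.
have GI g : g \in G -> ideal_of (graph_gens f Z) g by case: G_gb => + _; apply.
have Z'mem z : z \in Z' -> inclY n z \in G.
  by move=> zZ'; have := map_f (@inclY n m) zZ'; rewrite Z'G mem_filter => /andP[].
have redP p : p \in P -> normal_form (elim_le (varsY n m) le) G (inclX m p) (red (inclX m p)).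
  by move=> pP; apply/red_nf/map_f.
have red_ideal p : p \in P -> ideal_of (graph_gens f Z) (inclX m p - red (inclX m p)).
  by move=> /redP; apply: normal_form_ideal.
split.
  case=> a [b [Ia [c c0 bE] ->]].
  have /projP'[[d d0 db] _] : cone (map (@inclY n m) P') (inclY n b).
    exists (fun x => c (evalY x)) => //.
    rewrite bE rmorph_sum big_map; apply: eq_bigr => p _.
    by rewrite inclYK (rat_linear (rmorphB (@inclY n m))).
  (* Replace each normal form in the expression of [b] by the original [p], keeping its coefficient.
     The error [f b - b'] falls into the ideal of [Z], as [evalX] maps every [p - red p] there. *)
  pose e p := d (red (inclX m p)); pose b' := \sum_(p <- P) e p *: p.
  exists (f a + (f b - b')), b'; split; last by rewrite rmorphD addrA subrK.
    apply: ideal_genD.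
      rewrite -evalX_inclY; apply/graph_idealE.
      apply: (ideal_gen_rmorph (f := @inclY n m)) Ia => z /Z'mem; exact: GI.
    rewrite -evalX_inclY db !big_map rmorph_sum -sumrB.
    apply: ideal_gen_sum => p pP; rewrite (rat_linear (rmorphB (evalX f))) -scalerBr.
    apply: ideal_genZ; rewrite -opprB; apply: ideal_genN.
    by rewrite -{1}(inclXK f p) -rmorphB; apply/graph_idealE/red_ideal.
  by exists e => // p; apply: d0.
case=> a [b [Ia [c c0 bE] fqE]].
(* Conversely, normal forms replace the elements of [P], and [r] is compared with the remainder [r']
   of dividing [q] over Y. *)
pose r := \sum_(p <- P) c p *: red (inclX m p).
have [u [r' [Iu r'Y r'_red qE]]] := division_over G le_ord (inclY_over n q).
have rr' : r = r'.
  apply/eqP; rewrite -subr_eq0; apply/eqP.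
  apply: (reduced_ideal0 leW_ord G_gb); last first.
    apply: reducedB r'_red; apply: reduced_sum => p pP; apply: reducedZ.
    exact: normal_form_reduced (redP _ pP).
  (* All three summands lie in the graph ideal; for the middle one, [evalX] sends [q - b] to
     [f q - b = a]. *)
  have -> : r - r' = u + - (inclY n q - inclX m b) - (inclX m b - r).
    by rewrite qE; ring.
  apply: ideal_genB; first apply: ideal_genB.
  - by apply: ideal_gen_subset Iu => g [/GI].
  - apply/graph_idealE; rewrite rmorphB /= evalX_inclY inclXK fqE addrK.
    exact: Ia.
  - rewrite bE rmorph_sum -sumrB; apply: ideal_gen_sum => p pP.
    by rewrite (rat_linear (rmorphB (@inclX n m))) -scalerBr; apply/ideal_genZ/red_ideal.
(* The equality of remainders combines both conditions of the projection: [r] is in the cone of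
   normal forms, and [r'] is over Y. *)
have /projP'[d d0 r'E] : cone [seq red p | p <- map (@inclX n m) P] r' /\
    mnm_span (mnm_over (varsY n m)) r'.
  split; last by exists (msupp r'), (fun t => r'@_t); split; last exact: mpolyE.
  rewrite -rr'; apply: cone_sum => p pP; apply: cone_ray => //.
  by rewrite -map_comp; apply/mapP; exists p.
(* Applying [evalY] to [q = u + r'] gives the decomposition in Q[Y]; the generators of [u] are the
   elements of [G] over Y, that is, those of [Z']. *)
exists (evalY u), (evalY r'); split.
- apply: ideal_gen_rmorph Iu => g [gG gY]; apply: ideal_gen_mem.
  have : g \in map (@inclY n m) Z' by rewrite Z'G mem_filter gY.
  by case/mapP => z zZ' ->; rewrite /= inclYK.
- exists (fun p => d (inclY n p)) => [p|]; first exact: d0.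
  rewrite r'E big_map rmorph_sum; apply: eq_bigr => p _.
  by rewrite (rat_linear (rmorphB (@evalY n m))) /= inclYK.
- by rewrite -rmorphD -qE /= inclYK.
Qed.
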